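(* Let $G \in \widetilde{\mathbb{G}}$ and suppose that $G$ is not equal to any integer. Let $a<b$ be in $\mathbb{Z}[\frac12]$; below $t$ ranges over $\mathbb{Z}[\frac12]$. 1. If $\widetilde{\lambda}_t(G)$ is constant for $t \in (a,b]$, then for each $t \in (a,b]$, $(G^L)_t-t \lhd\!| \widetilde{\lambda}_t(G)$ for every Left option $G^L$ of $G$. 2. If $\widetilde{\rho}_t(G)$ is constant for $t \in (a,b]$, then for each $t \in (a,b]$, $\widetilde{\rho}_t(G) \lhd\!| (G^R)_t+t$ for every Right option $G^R$ of $G$. 3. If $\widetilde{\lambda}_t(G)$ is strictly decreasing for $t \in (a,b]$, then for each $t \in (a,b]$ there exists a Left option $G^L$ of $G$ such that $(G^L)_t-t \geq \widetilde{\lambda}_t(G)$. 4. If $\widetilde{\rho}_t(G)$ is strictly increasing for $t \in (a,b]$, then for each $t \in (a,b]$ there exists a Right option $G^R$ of $G$ such that $\widetilde{\rho}_t(G) \geq (G^R)_t+t$.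
   Context: Games. $\widetilde{\mathbb{G}}$ is the set of all formal (short, i.e. finite loopfree) normal-play partizan games $G=\{G^L\mid G^R\}$, where $G^L$ (resp. $G^R$) ranges over the finitely many Left (resp. Right) options of $G$; $\tilde b(G)$ is the formal birthday (height of the game tree). Sums and negatives of games are the usual ones; $G\ge 0$ means Left wins $G$ moving second under normal play, $G\ge H$ means $G-H\ge 0$, and $G$ is equal to $H$ (equality of game values) if $G\ge H$ and $H\ge G$. $G\lhd\!| H$ means $G\not\ge H$. The dyadic rationals $\mathbb{Z}[\frac12]$ are identified in the usual way with the numbers among game values; ''equal to an integer/number'' means having such a game value. When a dyadic rational is used as a formal game, its canonical form is meant. Cooling and temperature. For $G\in\widetilde{\mathbb{G}}$ and $t\in\mathbb{Z}[\frac12]$, define $\lambda_t(G),\rho_t(G)\in\mathbb{Z}[\frac12]$, $G_t\in\widetilde{\mathbb{G}}$ and $t(G)\in\mathbb{Z}[\frac12]\cup\{-\infty\}$ by recursion on $\tilde b(G)$ (this recursion is well-defined): - If $G$ is equal to an integer $n$: $\lambda_t(G)=\rho_t(G)=n$, $G_t=n$ (canonical form), $t(G)=-\infty$. - Otherwise let $\widetilde{\lambda}_t(G)=\max_{G^L}\{\rho_t(G^L)-t\}$, $\widetilde{\rho}_t(G)=\min_{G^R}\{\lambda_t(G^R)+t\}$, $\widetilde{G}_t=\{(G^L)_t-t\mid (G^R)_t+t\}$ (with all $G^L$, $G^R$), and $t(G)=\min\{t\in\mathbb{Z}[\frac12]\mid \widetilde{\lambda}_t(G)=\widetilde{\rho}_t(G)\}$.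 If $t\le t(G)$, set $\lambda_t(G)=\widetilde{\lambda}_t(G)$, $\rho_t(G)=\widetilde{\rho}_t(G)$, $G_t=\widetilde{G}_t$. If $t>t(G)$, set $\lambda_t(G)=\rho_t(G)=x$ and $G_t=x$ (canonical form), where $x=\lambda_{t(G)}(G)=\rho_{t(G)}(G)$. *)

(* Defs.v *)
From HB Require Import structures.
From mathcomp Require Import all_boot all_order all_algebra.
From mathcomp Require Import boolp classical_sets constructive_ereal.

Set Implicit Arguments.
Unset Strict Implicit.
Unset Printing Implicit Defensive.

Import Order.TTheory GRing.Theory Num.Theory.
Local Open Scope ring_scope.

(** * Dyadic rationals *)

Definition dyadic (x : rat) : Prop :=
  exists (k : int) (n : nat), x = k%:~R / 2 ^+ n.

(** * Formal short partizan games *)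

(* Options are given by finite lists: neither the order nor the repetition of
   options matters to anything below. *)
Inductive game : Type := Game of seq game & seq game.

(* Equality in this eqType is identity of formal games; it only serves to
   write [g \in left_opts G]. Equality of values is [eqg] below. *)
HB.instance Definition _ := gen_eqMixin game.

Definition left_opts (G : game) : seq game := let: Game L _ := G in L.
Definition right_opts (G : game) : seq game := let: Game _ R := G in R.

Fixpoint oppg (G : game) : game :=
  let: Game L R := G in Game (map oppg R) (map oppg L).

Fixpoint addg (G : game) : game -> game :=
  fix addG (H : game) : game :=
    let: Game GL GR := G in
    let: Game HL HR := H in
    Game (map (fun g => addg g H) GL ++ map addG HL)
         (map (fun g => addg g H) GR ++ map addG HR).

Definition subg (G H : game) : game := addg G (oppg H).

(* [left_wins true G] (resp. [left_wins false G]): Left wins G under normal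
   play when Left (resp. Right) moves first. *)
Fixpoint left_wins (left_starts : bool) (G : game) : bool :=
  let: Game L R := G in
  if left_starts then has (left_wins false) L else all (left_wins true) R.

Definition geg (G H : game) : bool := left_wins false (subg G H).
Definition eqg (G H : game) : bool := geg G H && geg H G.
Definition lfg (G H : game) : bool := ~~ geg G H.

Declare Scope game_scope.
Delimit Scope game_scope with game.
Bind Scope game_scope with game.
Notation "G + H" := (addg G H) : game_scope.
Notation "G - H" := (subg G H) : game_scope.
Notation "G >= H" := (geg G H) : game_scope.
Notation "G == H" := (eqg G H) : game_scope.
Notation "G <| H" := (lfg G H) (at level 70, no associativity) : game_scope.

(** * Canonical forms of dyadic rationals *)

Fixpoint nat_game (n : nat) : game :=
  if n is k.+1 then Game [:: nat_game k] [::] else Game [::] [::].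

Definition int_game (k : int) : game :=
  match k with
  | Posz n => nat_game n
  | Negz n => oppg (nat_game n.+1)
  end.

(* The canonical form of k / 2 ^ n; if k is odd and n > 0 it is
   {(k - 1) / 2 ^ n | (k + 1) / 2 ^ n}. *)
Fixpoint frac_game (n : nat) (k : int) : game :=
  if n is m.+1 then
    if (2 %| k)%Z then frac_game m (k %/ 2)%Z
    else Game [:: frac_game m ((k - 1) %/ 2)%Z] [:: frac_game m ((k + 1) %/ 2)%Z]
  else int_game k.

(* Only meaningful for dyadic x, whose reduced denominator is
   2 ^ logn 2 `|denq x|. *)
Definition num_game (x : rat) : game := frac_game (logn 2 `|denq x|%N) (numq x).

Definition equals_integer (G : game) : Prop :=
  exists n : int, (G == num_game n%:~R)%game.

(** * Cooling *)

(* The default values (on the empty list) are only reached for games with no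
   Left option or no Right option, and these are equal to integers. *)
Definition maxs (s : seq rat) : rat := \big[Num.max/head 0 s]_(x <- s) x.
Definition mins (s : seq rat) : rat := \big[Num.min/head 0 s]_(x <- s) x.

(* The data attached to a game G, as functions of t:
   lambda_t(G), rho_t(G), G_t; and t(G), with -oo allowed. *)
Record thermal := Thermal {
  th_lam : rat -> rat;
  th_rho : rat -> rat;
  th_cool : rat -> game;
  th_temp : \bar rat
}.

(* min {t in Z[1/2] | f t = g t}; this minimum exists for f = lambda~(G) and
   g = rho~(G) with G not equal to an integer, so the default 0 is not used. *)
Definition min_meet (f g : rat -> rat) : rat :=
  xget 0 [set m | [/\ dyadic m, f m = g m
                    & forall s, dyadic s -> f s = g s -> m <= s]]%classic.

Fixpoint thermo (G : game) : thermal :=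
  let: Game GL GR := G in
  let thL := map thermo GL in
  let thR := map thermo GR in
  let n : int := xget 0 [set n : int | (G == num_game n%:~R)%game]%classic in
  if (G == num_game n%:~R)%game then
    Thermal (fun=> n%:~R) (fun=> n%:~R) (fun=> num_game n%:~R) -oo%E
  else
    let lt t := maxs [seq th_rho l t - t | l <- thL] in
    let rt t := mins [seq th_lam r t + t | r <- thR] in
    let ct t := Game [seq (th_cool l t - num_game t)%game | l <- thL]
                     [seq (th_cool r t + num_game t)%game | r <- thR] in
    let m := min_meet lt rt in
    Thermal (fun t => if t <= m then lt t else lt m)
            (fun t => if t <= m then rt t else rt m)
            (fun t => if t <= m then ct t else num_game (lt m))
            m%:E.

Definition lam (t : rat) (G : game) : rat := th_lam (thermo G) t.
Definition rho (t : rat) (G : game) : rat := th_rho (thermo G) t.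
Definition cool (t : rat) (G : game) : game := th_cool (thermo G) t.
Definition temp (G : game) : \bar rat := th_temp (thermo G).

Definition lam_tilde (t : rat) (G : game) : rat :=
  maxs [seq rho t l - t | l <- left_opts G].
Definition rho_tilde (t : rat) (G : game) : rat :=
  mins [seq lam t r + t | r <- right_opts G].
Definition cool_tilde (t : rat) (G : game) : game :=
  Game [seq (cool t l - num_game t)%game | l <- left_opts G]
       [seq (cool t r + num_game t)%game | r <- right_opts G].

(* The recursion satisfied by these functions. *)

Lemma thermo_int (G : game) : equals_integer G ->
  exists n : int, [/\ (G == num_game n%:~R)%game, temp G = -oo%E
    & forall t, [/\ lam t G = n%:~R, rho t G = n%:~R
                  & cool t G = num_game n%:~R]].
Proof.
move=> [k Gk]; rewrite /lam /rho /cool /temp.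
set P := [set n : int | (G == num_game n%:~R)%game]%classic.
have Gn : (G == num_game (xget 0 P)%:~R)%game by exact: (@xgetI _ 0 P k).
exists (xget 0 P); split=> //.
  by case: G @P Gk Gn => GL GR P Gk Gn /=; rewrite -/P Gn.
by case: G @P Gk Gn => GL GR P Gk Gn t /=; rewrite -/P Gn.
Qed.

Lemma thermo_nonint (G : game) : ~ equals_integer G ->
  let m := min_meet (lam_tilde^~ G) (rho_tilde^~ G) in
  temp G = m%:E /\
  forall t,
    [/\ lam t G = if t <= m then lam_tilde t G else lam_tilde m G,
        rho t G = if t <= m then rho_tilde t G else rho_tilde m G
      & cool t G = if t <= m then cool_tilde t G
                   else num_game (lam_tilde m G)].
Proof.
move=> nG.
have nGk (k : int) : (G == num_game k%:~R)%game = false.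
  by apply/negP => Gk; apply: nG; exists k.
case: G nG nGk => GL GR _ nGk m.
have ltE : (fun t => maxs [seq th_rho l t - t | l <- map thermo GL])
           = lam_tilde^~ (Game GL GR).
  by apply/funext => t; rewrite -map_comp.
have rtE : (fun t => mins [seq th_lam r t + t | r <- map thermo GR])
           = rho_tilde^~ (Game GL GR).
  by apply/funext => t; rewrite -map_comp.
have mE : min_meet (fun t => maxs [seq th_rho l t - t | l <- map thermo GL])
            (fun t => mins [seq th_lam r t + t | r <- map thermo GR]) = m.
  by rewrite ltE rtE.
rewrite /lam /rho /cool /temp /= nGk /= mE; split=> // t.
by rewrite -!map_comp; split.
Qed.

(* Main.v *)
Require Import Defs.
From mathcomp Require Import all_boot all_order all_algebra.
From mathcomp Require Import boolp classical_sets constructive_ereal.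
From mathcomp Require Import zify ring lra.
Import Order.TTheory GRing.Theory Num.Theory.
Local Open Scope ring_scope.

Set Implicit Arguments.
Unset Strict Implicit.
Unset Printing Implicit Defensive.

(* Negation exchanges lambda and rho, so only rho and Left options matter.
   By induction on G, for every dyadic x, G_t >= x if x < rho_t(G) and not if
   x > rho_t(G), while the comparison of G_t with rho_t(G) itself is decided by
   the slope of rho to the left of t: G_t >= rho_t(G) if the slope is 0, and not
   if it is 1.  The induction step is number avoidance, the case where G_t is a
   number z being harmless since then lambda~_t(G) <= z.  If lambda~(G) is
   constant to the left of t, an option with rho_t(G^L) - t = lambda~_t(G) must
   have slope 1; if it has slope -1, an option attaining lambda~ to the left of t
   has slope 0 and still attains it at t.

   Walls are handled as monotone 1-Lipschitz functions that map the grid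
   2^-n Z to itself for all large n, which forces slope 0 or 1 on each cell.
   That the walls of a non-integer G meet, and do so first at some t > -1, comes
   from t = -1: there the walls are integers, and if lambda~ <= rho~ then an
   integer would fit between the Left and the Right options of G. *)

(** * Games *)

Fixpoint gsize (G : game) : nat :=
  let: Game L R := G in (sumn (map gsize L) + sumn (map gsize R)).+1.

Lemma leq_sumn (s : seq nat) x : x \in s -> (x <= sumn s)%N.
Proof.
elim: s => //= y s IH; rewrite inE => /orP[/eqP->|/IH]; first exact: leq_addr.
by move=> h; apply: leq_trans h (leq_addl _ _).
Qed.

Lemma gsize_left G l : l \in left_opts G -> (gsize l < gsize G)%N.
Proof.
case: G => L R /= /(map_f gsize)/leq_sumn h.
by rewrite ltnS (leq_trans h) // leq_addr.
Qed.

Lemma gsize_right G r : r \in right_opts G -> (gsize r < gsize G)%N.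
Proof.
case: G => L R /= /(map_f gsize)/leq_sumn h.
by rewrite ltnS (leq_trans h) // leq_addl.
Qed.

(** The options sit inside lists, where the generated induction principle gives no hypothesis about
    them; induction on [gsize] supplies it. *)
Lemma game_opts_ind (P : game -> Prop) :
  (forall G, (forall l, l \in left_opts G -> P l) ->
             (forall r, r \in right_opts G -> P r) -> P G) ->
  forall G, P G.
Proof.
move=> step G; have [n] := ubnP (gsize G); elim: n G => // n IH G leGn.
apply: step => H oH; apply: IH.
- by apply: leq_trans (gsize_left oH) _.
- by apply: leq_trans (gsize_right oH) _.
Qed.

(** * Negation and sums of formal games *)

Lemma game_ext G H :
  left_opts G = left_opts H -> right_opts G = right_opts H -> G = H.
Proof. by case: G H => ? ? [? ?] /= -> ->. Qed.

Lemma left_opts_opp G : left_opts (oppg G) = map oppg (right_opts G).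
Proof. by case: G. Qed.

Lemma right_opts_opp G : right_opts (oppg G) = map oppg (left_opts G).
Proof. by case: G. Qed.

Lemma left_opts_add G H : left_opts (addg G H) =
  map (fun g => addg g H) (left_opts G) ++ map (addg G) (left_opts H).
Proof. by case: G H => ? ? []. Qed.

Lemma right_opts_add G H : right_opts (addg G H) =
  map (fun g => addg g H) (right_opts G) ++ map (addg G) (right_opts H).
Proof. by case: G H => ? ? []. Qed.

Lemma oppgK : involutive oppg.
Proof.
elim/game_opts_ind => G IHL IHR.
apply: game_ext; rewrite !(left_opts_opp, right_opts_opp) -map_comp.
- exact: map_id_in.
- exact: map_id_in.
Qed.

Lemma gsize_opp G : gsize (oppg G) = gsize G.
Proof.
elim/game_opts_ind: G => -[L R] /= IHL IHR.
rewrite addnC -!map_comp; congr (_ + _).+1; congr sumn.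
- exact/eq_in_map/IHL.
- exact/eq_in_map/IHR.
Qed.

Lemma oppgD G H : oppg (addg G H) = addg (oppg G) (oppg H).
Proof.
elim/game_opts_ind: G H => G IHL IHR; elim/game_opts_ind => H IHL' IHR'.
apply: game_ext.
- rewrite left_opts_opp left_opts_add right_opts_add !left_opts_opp map_cat.
  rewrite -!map_comp; congr cat; apply/eq_in_map => g og /=; auto.
- rewrite right_opts_opp left_opts_add right_opts_add !right_opts_opp map_cat.
  rewrite -!map_comp; congr cat; apply/eq_in_map => g og /=; auto.
Qed.

Lemma addgA G H K : addg G (addg H K) = addg (addg G H) K.
Proof.
elim/game_opts_ind: G H K => G IHL IHR; elim/game_opts_ind => H IHL' IHR'.
elim/game_opts_ind => K IHL'' IHR''.
apply: game_ext.
- rewrite !left_opts_add !map_cat -!map_comp -catA.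
  by congr (_ ++ (_ ++ _)); apply/eq_in_map => g og /=; auto.
- rewrite !right_opts_add !map_cat -!map_comp -catA.
  by congr (_ ++ (_ ++ _)); apply/eq_in_map => g og /=; auto.
Qed.

Lemma addg0 G : addg G (Game [::] [::]) = G.
Proof.
elim/game_opts_ind: G => G IHL IHR.
apply: game_ext; rewrite (left_opts_add, right_opts_add) cats0.
- exact: map_id_in.
- exact: map_id_in.
Qed.

(** * Outcomes and the order on games *)

Lemma left_wins_true G :
  left_wins true G = has (left_wins false) (left_opts G).
Proof. by case: G. Qed.

Lemma left_wins_false G :
  left_wins false G = all (left_wins true) (right_opts G).
Proof. by case: G. Qed.

Lemma left_wins_opp b G : left_wins b (oppg G) = ~~ left_wins (~~ b) G.
Proof.
elim/game_opts_ind: G b => G IHL IHR [] /=.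
- rewrite left_wins_true left_wins_false left_opts_opp has_map -has_predC.
  by apply: eq_in_has => r /IHR /= ->.
- rewrite left_wins_true left_wins_false right_opts_opp all_map -all_predC.
  by apply: eq_in_all => r /IHL /= ->.
Qed.

(** The two sums list their options in different orders, so they differ as formal games; only their
    outcomes are compared, which is all the order sees. Associativity, by contrast, is an identity
    of formal games. *)
Lemma left_wins_addC b G H : left_wins b (addg G H) = left_wins b (addg H G).
Proof.
elim/game_opts_ind: G H b => G IHL IHR; elim/game_opts_ind => H IHL' IHR' [].
- rewrite !left_wins_true !left_opts_add !has_cat !has_map orbC.
  congr orb; apply: eq_in_has => g og /=; [exact: IHL' | exact: IHL].
- rewrite !left_wins_false !right_opts_add !all_cat !all_map andbC.
  congr andb; apply: eq_in_all => g og /=; [exact: IHR' | exact: IHR].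
Qed.

Lemma geg_opp G H : geg (oppg G) (oppg H) = geg H G.
Proof. by rewrite /geg /subg oppgK left_wins_addC. Qed.

Lemma left_wins_true_sub G H : left_wins true (subg G H) = ~~ geg H G.
Proof.
rewrite -[subg G H]oppgK left_wins_opp /subg oppgD oppgK left_wins_addC.
by [].
Qed.

Lemma geg_subl G H K : geg (subg G H) K = geg G (addg H K).
Proof. by rewrite /geg /subg oppgD addgA. Qed.

(** Conway's recursive form of the order: Right moves in [G] or in [oppg H], and Left wins the
    resulting difference moving first exactly when the reverse comparison fails. *)
Lemma gegE G H :
  geg G H = all (fun r => ~~ geg H r) (right_opts G)
            && all (fun l => ~~ geg l G) (left_opts H).
Proof.
rewrite {1}/geg left_wins_false /subg right_opts_add all_cat right_opts_opp.
rewrite !all_map; congr andb; apply: eq_in_all => g og /=;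
  exact: left_wins_true_sub.
Qed.

Lemma gegP G H :
  reflect ((forall r, r \in right_opts G -> ~~ geg H r) /\
           (forall l, l \in left_opts H -> ~~ geg l G)) (geg G H).
Proof.
rewrite gegE; apply: (iffP andP) => -[h1 h2]; split; try exact/allP.
Qed.

Lemma geg_refl G : geg G G.
Proof.
elim/game_opts_ind: G => G IHL IHR; apply/gegP; split => g og; apply/negP.
- by move=> /gegP[/(_ g og)]; rewrite IHR.
- by move=> /gegP[_ /(_ g og)]; rewrite IHL.
Qed.

(** An option [g] refuting the conclusion gives a chain [H >= K >= g] or [g >= G >= H] of smaller
    total size, and its composite contradicts a hypothesis. *)
Lemma geg_trans H G K : geg G H -> geg H K -> geg G K.
Proof.
have [n] := ubnP (gsize G + gsize H + gsize K).
elim: n G H K => // n IH G H K le_n GH HK.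
apply/gegP; split=> g og; apply/negP => h.
- have /gegP[/(_ g og)/negP nHg _] := GH; apply/nHg/(IH H K g) => //.
  by have := gsize_right og; lia.
- have /gegP[_ /(_ g og)/negP ngH] := HK; apply/ngH/(IH g G H) => //.
  by have := gsize_left og; lia.
Qed.

(** * Canonical dyadic games *)

(** For dyadic [x], the least [n] such that [x] lies on the grid of multiples of [1 / 2 ^ n]. *)
Definition ord2 (x : rat) : nat := logn 2 `|denq x|%N.

Lemma expr2_gt0 n : 0 < 2 ^+ n :> rat.
Proof. by rewrite exprn_gt0. Qed.

Lemma expr2_neq0 n : 2 ^+ n != 0 :> rat.
Proof. by rewrite gt_eqF ?expr2_gt0. Qed.

Lemma dyadicE x : dyadic x <-> exists n, x * 2 ^+ n \is a Num.int.
Proof.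
split=> [[k [n ->]]|[n /intrP[k kE]]].
- by exists n; rewrite divfK ?expr2_neq0 ?intr_int.
- by exists k, n; rewrite -kE mulfK ?expr2_neq0.
Qed.


Lemma coprime_odd_expr2 (k : int) n : ~~ (2 %| k)%Z ->
  coprime `|k| `|2 ^+ n : int|.
Proof.
move=> k_odd; rewrite abszX; apply: coprimeXr.
by rewrite coprime_sym prime_coprime.
Qed.

Lemma numq_odd (k : int) n : ~~ (2 %| k)%Z -> numq (k%:~R / 2 ^+ n) = k.
Proof.
move=> /(@coprime_odd_expr2 k n) /coprimeq_num.
by rewrite rmorphXn /= => ->; rewrite gtr0_sg ?mul1r ?exprn_gt0.
Qed.

Lemma ord2_odd (k : int) n : ~~ (2 %| k)%Z -> ord2 (k%:~R / 2 ^+ n) = n.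
Proof.
move=> /(@coprime_odd_expr2 k n) /coprimeq_den; rewrite /ord2 rmorphXn /= => ->.
by rewrite expf_eq0 andbF normrX abszX pfactorK.
Qed.

Lemma ord2_int (k : int) : ord2 k%:~R = 0%N.
Proof. by rewrite /ord2 denq_int. Qed.

Lemma num_game_int (k : int) : num_game k%:~R = int_game k.
Proof. by rewrite /num_game -/(ord2 _) ord2_int numq_int. Qed.

Lemma frac_gameE n (k : int) : frac_game n k = num_game (k%:~R / 2 ^+ n).
Proof.
elim: n k => [|n IH] k; first by rewrite expr0 divr1 num_game_int.
case: (boolP (2 %| k)%Z) => [k_even|k_odd]; last first.
  by rewrite /num_game -/(ord2 _) ord2_odd // numq_odd.
rewrite /= k_even IH -{2}(divzK k_even) exprSr rmorphM /= invfM.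
by rewrite -mulrA (mulrC _^-1) mulVKf.
Qed.

Lemma num_game_odd n (k : int) (d := (2 ^+ n.+1)^-1) : ~~ (2 %| k)%Z ->
  num_game (k%:~R / 2 ^+ n.+1) =
  Game [:: num_game (k%:~R / 2 ^+ n.+1 - d)]
       [:: num_game (k%:~R / 2 ^+ n.+1 + d)].
Proof.
move=> k_odd; rewrite {1}/num_game -/(ord2 _) ord2_odd // numq_odd //=.
rewrite (negbTE k_odd) !frac_gameE /d.
have halve (j : int) : (2 %| j)%Z ->
    (j %/ 2)%Z%:~R / 2 ^+ n = j%:~R / 2 ^+ n.+1 :> rat.
  move=> j_even; rewrite -{2}(divzK j_even) exprSr rmorphM /= invfM.
  by rewrite -mulrA (mulrC _^-1) mulVKf.
have kE : k = (k %/ 2)%Z * 2 + 1 by move: k_odd => /dvdz_mod0P; lia.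
have [kD1 kB1] : (2 %| k + 1)%Z /\ (2 %| k - 1)%Z.
  by split; apply/dvdzP; [exists ((k %/ 2)%Z + 1) | exists (k %/ 2)%Z]; lia.
by rewrite !halve // rmorphB rmorphD /= mulrBl mulrDl mul1r.
Qed.

Variant dyadic_spec (x : rat) : Prop :=
| DyadicInt (k : int) of x = k%:~R
| DyadicOdd n (k : int) of x = k%:~R / 2 ^+ n.+1 & ~~ (2 %| k)%Z.

Lemma dyadicP x : dyadic x -> dyadic_spec x.
Proof.
case=> k [n ->]; elim: n k => [|n IH] k.
  by apply: (@DyadicInt _ k); rewrite expr0 divr1.
case: (boolP (2 %| k)%Z) => [k_even|]; last exact: DyadicOdd.
rewrite -(divzK k_even) exprSr rmorphM /= invfM.
by rewrite -mulrA (mulrC _^-1) mulVKf.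
Qed.

Lemma ord2_grid x n : dyadic x -> (ord2 x <= n)%N -> x * 2 ^+ n \is a Num.int.
Proof.
case/dyadicP=> [k ->|m k -> k_odd].
  by rewrite rpredM ?rpredX ?intr_int.
rewrite ord2_odd // => le_mn.
rewrite -(subnKC le_mn) exprD mulrA divfK ?expr2_neq0 //.
by rewrite rpredM ?rpredX ?intr_int.
Qed.

Lemma int_game_opp k : int_game (- k) = oppg (int_game k).
Proof. by case: k => [[|n]|n] //; rewrite [in RHS]/int_game oppgK. Qed.

(** One formula serves both kinds of canonical form: an integer has [ord2 x = 0], hence step 1 and
    at most one option, towards 0; a fraction has both grid neighbours as options. *)
Lemma num_game_opts x (d := (2 ^+ ord2 x)^-1) : dyadic x ->
  num_game x =
  Game (if (0 < ord2 x)%N || (0 < x) then [:: num_game (x - d)] else [::])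
       (if (0 < ord2 x)%N || (x < 0) then [:: num_game (x + d)] else [::]).
Proof.
case/dyadicP => [k xE|n k xE k_odd]; last first.
  by rewrite xE num_game_odd // /d xE ord2_odd.
rewrite /d xE ord2_int expr0 invr1 /= ltr0z ltrz0.
case: k {xE} => [[|n]|n].
- by rewrite num_game_int.
- by rewrite num_game_int /= intS rmorphD /= addrAC subrr add0r num_game_int.
- have -> : (Negz n)%:~R + 1 = (- n%:Z)%:~R :> rat.
    by rewrite NegzE -addn1 PoszD opprD rmorphD rmorphN1 subrK.
  by rewrite !num_game_int int_game_opp.
Qed.

Lemma num_gameN x : num_game (- x) = oppg (num_game x).
Proof.
rewrite /num_game denqN numqN; move: (logn _ _) (numq x) => n.
elim: n => [|n IH] k; first exact: int_game_opp.
rewrite /= (_ : (2 %| - k)%Z = (2 %| k)%Z); last by rewrite !dvdzE abszN.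
case: (boolP (2 %| k)%Z) => [/dvdzP[j ->]|k_odd].
  by rewrite -mulNr !mulzK // IH.
have kE : k = (k %/ 2)%Z * 2 + 1 by move: k_odd => /dvdz_mod0P; lia.
set j := (k %/ 2)%Z in kE; rewrite kE /= -!IH.
by congr Game; congr [:: frac_game _ _]; lia.
Qed.

Lemma dyadicN x : dyadic x -> dyadic (- x).
Proof.
by move=> /dyadicE[n xn]; apply/dyadicE; exists n; rewrite mulNr rpredN.
Qed.

Lemma dyadicD x y : dyadic x -> dyadic y -> dyadic (x + y).
Proof.
move=> dx dy; apply/dyadicE; exists (maxn (ord2 x) (ord2 y)).
by rewrite mulrDl rpredD // ord2_grid // (leq_maxl, leq_maxr).
Qed.

Lemma dyadicB x y : dyadic x -> dyadic y -> dyadic (x - y).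
Proof. by move=> dx /dyadicN; exact: dyadicD. Qed.

Lemma dyadic_int (k : int) : dyadic k%:~R.
Proof. by exists k, 0%N; rewrite expr0 divr1. Qed.

Lemma dyadic_Vexpr2 n : dyadic (2 ^+ n)^-1.
Proof. by exists 1, n; rewrite mul1r. Qed.

Lemma Vexpr2_gt0 n : 0 < (2 ^+ n)^-1 :> rat.
Proof. by rewrite invr_gt0 expr2_gt0. Qed.

(** * Play in sums of numbers *)

(** Lists of any length, since comparing numbers takes two summands and additivity takes three. *)
Definition num_sum (s : seq rat) : game :=
  foldr (fun x => addg (num_game x)) (Game [::] [::]) s.

Lemma left_opts_num_sum s1 x s2 : dyadic x -> (0 < ord2 x)%N || (0 < x) ->
  num_sum (s1 ++ (x - (2 ^+ ord2 x)^-1) :: s2)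
    \in left_opts (num_sum (s1 ++ x :: s2)).
Proof.
move=> dx hx; elim: s1 => [|y s1 IH]; rewrite /= left_opts_add mem_cat.
  by rewrite [num_game x]num_game_opts // hx /= inE eqxx.
by rewrite (map_f (addg _)) ?orbT.
Qed.

Lemma right_opts_num_sum s r : (forall x, x \in s -> dyadic x) ->
  r \in right_opts (num_sum s) ->
  exists s1 x s2, s = s1 ++ x :: s2 /\
    r = num_sum (s1 ++ (x + (2 ^+ ord2 x)^-1) :: s2).
Proof.
elim: s r => [//|x s IH] r ds /=; rewrite right_opts_add mem_cat.
have dx : dyadic x by apply: ds; rewrite mem_head.
case/orP=> /mapP[g og ->].
- exists [::], x, s; split => //=; move: og.
  rewrite num_game_opts //=; case: ifP => // _.
  by rewrite inE => /eqP ->.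
- have [|s1 [y [s2 [-> ->]]]] := IH g _ og.
    by move=> y ys; apply: ds; rewrite inE ys orbT.
  by exists (x :: s1), y, s2.
Qed.

(* Moving in a summand of maximal denominator 2 ^ N changes the total by
   2 ^- N, the least change that keeps a positive total nonnegative. *)
Lemma num_sum_wins s : (forall x, x \in s -> dyadic x) ->
  (0 <= \sum_(x <- s) x -> left_wins false (num_sum s)) /\
  (0 < \sum_(x <- s) x -> left_wins true (num_sum s)).
Proof.
have [n] := ubnP (gsize (num_sum s)); elim: n s => // n IH s le_n ds.
split=> s_ge0.
- rewrite left_wins_false; apply/allP => r or.
  have [s1 [x [s2 [sE rE]]]] := right_opts_num_sum ds or.
  have dx : dyadic x by apply: ds; rewrite sE mem_cat mem_head orbT.
  rewrite rE; apply IH.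
  + by rewrite -rE; apply: leq_trans (gsize_right or) _.
  + move=> y; rewrite mem_cat inE => /or3P[ys|/eqP ->|ys].
    * by apply: ds; rewrite sE mem_cat ys.
    * exact/dyadicD/dyadic_Vexpr2.
    * by apply: ds; rewrite sE mem_cat inE ys !orbT.
  + move: s_ge0; rewrite sE !big_cat !big_cons /=.
    have := Vexpr2_gt0 (ord2 x); lra.
- pose N := (\max_(x <- s) ord2 x)%N.
  have ord_le x : x \in s -> (ord2 x <= N)%N by move=> xs; apply: leq_bigmax_seq.
  have sumN : (2 ^+ N)^-1 <= \sum_(x <- s) x.
    have : (\sum_(x <- s) x) * 2 ^+ N \is a Num.int.
      rewrite mulr_suml big_seq rpred_sum // => x xs.
      by rewrite ord2_grid ?ord_le //; apply: ds.
    move=> /intrP[k kE].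
    have : 0 < (\sum_(x <- s) x) * 2 ^+ N by rewrite mulr_gt0 ?expr2_gt0.
    by rewrite -[_^-1]mul1r ler_pdivrMr ?expr2_gt0 // kE ltr0z ler1z.
  (* Left needs a summand of maximal denominator in which a move exists. If [N = 0] all summands are
     integers and a positive one will do; if [N > 0] every summand with [ord2 x = N] has a Left
     option. *)
  have [x xs /andP[hx /eqP ordN]] :
      exists2 x, x \in s & ((0 < ord2 x)%N || (0 < x)) && (ord2 x == N).
    case: (posnP N) => [N0|N_gt0].
    + have [/hasP[x xs x_gt0]|/hasPn s_le0] := boolP (has (fun x => 0 < x) s).
        exists x => //; rewrite x_gt0 orbT /= N0.
        by have := ord_le _ xs; rewrite N0 leqn0.
      move: s_ge0; rewrite ltNge big_seq sumr_le0 // => x /s_le0.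
      by rewrite -leNgt.
    + have [/hasP[x xs xN]|/hasPn s_ltN] :=
        boolP (has (fun x => ord2 x == N) s).
        by exists x => //; rewrite (eqP xN) N_gt0 eqxx.
      suff : (N <= N.-1)%N by rewrite leqNgt ltn_predL N_gt0.
      apply/bigmax_leqP_seq => x xs _; rewrite -ltnS prednK //.
      by rewrite ltn_neqAle s_ltN // ord_le.
  have dx := ds _ xs.
  case/splitPr: xs s_ge0 sumN le_n ds => s1 s2 s_ge0 sumN le_n ds.
  have ol := left_opts_num_sum s1 s2 dx hx.
  rewrite left_wins_true; apply/hasP.
  exists (num_sum (s1 ++ (x - (2 ^+ ord2 x)^-1) :: s2)) => //.
  apply IH.
  + exact: leq_trans (gsize_left ol) _.
  + move=> y; rewrite mem_cat inE => /or3P[ys|/eqP ->|ys].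
    * by apply: ds; rewrite mem_cat ys.
    * exact/dyadicB/dyadic_Vexpr2.
    * by apply: ds; rewrite mem_cat inE ys !orbT.
  + by move: sumN; rewrite -ordN !big_cat !big_cons /=; lra.
Qed.

Lemma geg_num x y : dyadic x -> dyadic y ->
  geg (num_game x) (num_game y) = (y <= x).
Proof.
move=> dx dy.
have win2 u v : dyadic u -> dyadic v ->
    (0 <= u + v -> left_wins false (addg (num_game u) (num_game v))) /\
    (0 < u + v -> left_wins true (addg (num_game u) (num_game v))).
  move=> du dv; have := @num_sum_wins [:: u; v].
  rewrite /= addg0 !big_cons big_nil addr0; apply=> z.
  by rewrite !inE => /orP[]/eqP->.
apply/idP/idP => [|le_yx]; last first.
  rewrite /geg /subg -num_gameN //; apply win2 => //; first exact: dyadicN.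
  by rewrite subr_ge0.
apply: contraLR; rewrite -ltNge => lt_xy; rewrite -left_wins_true_sub.
rewrite /subg -num_gameN //; apply win2 => //; first exact: dyadicN.
by rewrite subr_gt0.
Qed.

Lemma eqg_num x y : dyadic x -> dyadic y ->
  eqg (num_game x) (num_game y) -> x = y.
Proof.
move=> dx dy; rewrite /eqg !geg_num // => /andP[h1 h2].
by apply/eqP; rewrite eq_le h1 h2.
Qed.

Lemma eqg_num_add x y : dyadic x -> dyadic y ->
  eqg (addg (num_game x) (num_game y)) (num_game (x + y)).
Proof.
move=> dx dy; have dxy := dyadicD dx dy.
have win3 u v w : dyadic u -> dyadic v -> dyadic w -> u + v + w = 0 ->
    left_wins false (addg (num_game u) (addg (num_game v) (num_game w))).
  move=> du dv dw uvw; have := @num_sum_wins [:: u; v; w].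
  rewrite /= addg0 !big_cons big_nil addr0 addrA uvw lexx.
  case=> [z|/(_ isT)//].
  by rewrite !inE => /or3P[]/eqP->.
apply/andP; split; rewrite /geg /subg.
- rewrite -num_gameN // -addgA; apply: win3 => //; first exact: dyadicN.
  by rewrite subrr.
- rewrite oppgD -!num_gameN //; apply: win3; rewrite ?subrr //;
    try exact: dyadicN.
  by ring.
Qed.

(** * Number avoidance *)

Lemma geg_sub_num X t x : dyadic t -> dyadic x ->
  geg (subg X (num_game t)) (num_game x) = geg X (num_game (t + x)).
Proof.
move=> dt dx; rewrite geg_subl; have /andP[h1 h2] := eqg_num_add dt dx.
by apply/idP/idP => h; apply: geg_trans h _.
Qed.

(** Left's winning first move in [G - x] either is made in [G], or replaces [x] by its Right option
    [y > x] with [G >= y]; in the latter case [G] equals [y] or the induction applies to [y]. The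
    integrality clause lets an integer [x] rule out the second alternative when [G] is not an
    integer. *)
Lemma geg_left_num G x : dyadic x -> ~~ geg (num_game x) G ->
  (exists2 l, l \in left_opts G & geg l (num_game x)) \/
  (exists y, [/\ dyadic y, x \is a Num.int -> y \is a Num.int
                & eqg G (num_game y)]).
Proof.
have [n] := ubnP (gsize (num_game x)); elim: n x => // n IH x le_n dx.
rewrite gegE negb_and => /orP[]; last first.
  by case/allPn => l ol; rewrite negbK => h; left; exists l.
case/allPn => r or; rewrite negbK => Gr.
have [y [dy yint rE xy]] : exists y, [/\ dyadic y,
    x \is a Num.int -> y \is a Num.int, r = num_game y & x < y].
  move: or; rewrite num_game_opts //=; case: ifP => // _.
  rewrite inE => /eqP ->.
  exists (x + (2 ^+ ord2 x)^-1); split=> //.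
  - exact/dyadicD/dyadic_Vexpr2.
  - move=> /intrP[k ->].
    by rewrite ord2_int expr0 invr1 rpredD ?intr_int ?rpred1.
  - by rewrite ltrDl Vexpr2_gt0.
move: rE or Gr => -> or Gy.
have [yG|nyG] := boolP (geg (num_game y) G).
  by right; exists y; split=> //; rewrite /eqg Gy.
have [|[l ol ly]|[z [dz zint Gz]]] := IH y _ dy nyG.
- by apply: leq_trans (gsize_right or) _.
- by left; exists l => //; apply: geg_trans ly _; rewrite geg_num // ltW.
- by right; exists z; split=> // /yint/zint.
Qed.

(** If the comparison fails, number avoidance for [oppg G] yields a Right option below [x], which is
    excluded, or a number. *)
Lemma geg_right_num G x : dyadic x ->
  (forall r, r \in right_opts G -> ~~ geg (num_game x) r) ->
  geg G (num_game x) \/ (exists2 y, dyadic y & eqg G (num_game y)).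
Proof.
move=> dx xR; have [|nGx] := boolP (geg G (num_game x)); [by left|right].
have [||[l]|[y [dy _ Gy]]] := @geg_left_num (oppg G) (- x); first exact: dyadicN.
- by rewrite num_gameN // geg_opp.
- rewrite left_opts_opp => /mapP[r or ->].
  by rewrite num_gameN // geg_opp (negbTE (xR r or)).
- exists (- y); first exact: dyadicN.
  by rewrite num_gameN // /eqg -geg_opp -[in X in _ && X]geg_opp !oppgK andbC.
Qed.

(** * Thermographs *)

Lemma maxsN (s : seq rat) : maxs (map -%R s) = - mins s.
Proof.
rewrite /maxs /mins (_ : head 0 (map -%R s) = - head 0 s); last first.
  by case: s => //=; rewrite oppr0.
rewrite big_map; move: (head 0 s) => a.
by elim: s => [|x s IH]; rewrite ?big_nil // !big_cons IH oppr_min.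
Qed.

Lemma minsN (s : seq rat) : mins (map -%R s) = - maxs s.
Proof.
by have := maxsN (map -%R s); rewrite (mapK opprK) => ->; rewrite opprK.
Qed.

Lemma mins_le (s : seq rat) x : x \in s -> mins s <= x.
Proof.
rewrite /mins; move: (head 0 s) => a.
elim: s => // y s IH; rewrite inE big_cons ge_min => /orP[/eqP->|/IH->].
- by rewrite lexx.
- by rewrite orbT.
Qed.

Lemma mins_mem (s : seq rat) : s != [::] -> mins s \in s.
Proof.
case: s => // a s _; rewrite /mins /=; set m := \big[_/_]_(_ <- _) _.
suff : m \in a :: a :: s by rewrite !inE orbA orbb.
rewrite {}/m; elim: (a :: s) => [|y r IH]; first by rewrite big_nil mem_head.
rewrite big_cons minElt; case: ifP => _; first by rewrite !inE eqxx orbT.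
by move: IH; rewrite !inE => /orP[->//|->]; rewrite !orbT.
Qed.

Lemma eqg_opp G H : eqg (oppg G) (oppg H) = eqg G H.
Proof. by rewrite /eqg !geg_opp andbC. Qed.

Lemma eqg_sym G H : eqg G H = eqg H G.
Proof. by rewrite /eqg andbC. Qed.

Lemma eqg_trans H G K : eqg G H -> eqg H K -> eqg G K.
Proof.
move=> /andP[GH HG] /andP[HK KH].
by rewrite /eqg (geg_trans GH HK) (geg_trans KH HG).
Qed.

Lemma equals_integer_opp G : equals_integer (oppg G) <-> equals_integer G.
Proof.
suff imp H : equals_integer H -> equals_integer (oppg H).
  by split=> /imp; rewrite ?oppgK.
by case=> k Hk; exists (- k); rewrite rmorphN /= num_gameN eqg_opp.
Qed.

(** The inductive step of [lam_rho_opp], with the hypothesis on options as a premise. *)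
Lemma lam_tilde_opp_of t G :
    (forall r, r \in right_opts G -> rho t (oppg r) = - lam t r) ->
  lam_tilde t (oppg G) = - rho_tilde t G.
Proof.
move=> IH; rewrite /lam_tilde /rho_tilde -maxsN left_opts_opp -!map_comp.
congr maxs; apply/eq_in_map => r /IH /= ->.
by rewrite opprD.
Qed.

Lemma rho_tilde_opp_of t G :
    (forall l, l \in left_opts G -> lam t (oppg l) = - rho t l) ->
  rho_tilde t (oppg G) = - lam_tilde t G.
Proof.
move=> IH; rewrite /lam_tilde /rho_tilde -minsN right_opts_opp -!map_comp.
congr mins; apply/eq_in_map => r /IH /= ->.
by rewrite opprB addrC.
Qed.

Lemma min_meetN (f g : rat -> rat) :
  min_meet (fun t => - f t) (fun t => - g t) = min_meet g f.
Proof.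
rewrite /min_meet; congr (xget 0 _); apply/funext => m; apply/propext.
split=> -[dm e h]; split=> //.
- exact: oppr_inj.
- by move=> s ds gf; apply: h => //; rewrite gf.
- by rewrite e.
- by move=> s ds /oppr_inj fg; apply: h.
Qed.

Lemma lam_rho_opp t G :
  lam t (oppg G) = - rho t G /\ rho t (oppg G) = - lam t G.
Proof.
elim/game_opts_ind: G t => G IHL IHR t.
have [Gint|Gnint] := pselect (equals_integer G).
  have [n [Gn _ /(_ t)[-> -> _]]] := thermo_int Gint.
  have /equals_integer_opp/thermo_int[k [Gk _ /(_ t)[-> -> _]]] := Gint.
  (* The integers attached to [G] and to [oppg G] are chosen independently; they are opposite
     because equal numbers have equal values. *)
  have -> : k%:~R = - n%:~R :> rat; last by rewrite ?opprK.
  apply: eqg_num; [exact: dyadic_int|exact/dyadicN/dyadic_int|].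
  by rewrite num_gameN; apply: eqg_trans (_ : eqg _ (oppg G)) _;
    rewrite ?eqg_opp // eqg_sym.
have ltE u : lam_tilde u (oppg G) = - rho_tilde u G.
  by apply: lam_tilde_opp_of => r /IHR/(_ u)[].
have rtE u : rho_tilde u (oppg G) = - lam_tilde u G.
  by apply: rho_tilde_opp_of => r /IHL/(_ u)[].
have [_ /(_ t)[-> -> _]] := thermo_nonint Gnint.
have /thermo_nonint[_ /(_ t)[-> -> _]] : ~ equals_integer (oppg G).
  by move=> /equals_integer_opp.
rewrite (_ : lam_tilde^~ (oppg G) = fun u => - rho_tilde u G); last exact/funext.
rewrite (_ : rho_tilde^~ (oppg G) = fun u => - lam_tilde u G); last exact/funext.
by rewrite min_meetN !ltE !rtE; split; case: ifP.
Qed.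

Lemma lam_opp t G : lam t (oppg G) = - rho t G.
Proof. by case: (lam_rho_opp t G). Qed.

Lemma rho_opp t G : rho t (oppg G) = - lam t G.
Proof. by case: (lam_rho_opp t G). Qed.

Lemma lam_tilde_opp t G : lam_tilde t (oppg G) = - rho_tilde t G.
Proof. by apply: lam_tilde_opp_of => r _; rewrite rho_opp. Qed.

Lemma rho_tilde_opp t G : rho_tilde t (oppg G) = - lam_tilde t G.
Proof. by apply: rho_tilde_opp_of => r _; rewrite lam_opp. Qed.

(** * Piecewise linear walls without breakpoints *)

(** Chosen so that truncation, [t - f t] and finite minima preserve it with no list of breakpoints
    to maintain. Right walls satisfy it directly, Left walls after a change of sign. *)
Definition tame (f : rat -> rat) : Prop :=
  (forall s t : rat, s <= t -> f s <= f t <= f s + (t - s)) /\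
  exists N, forall n, (N <= n)%N -> forall x : rat,
    x * 2 ^+ n \is a Num.int -> f x * 2 ^+ n \is a Num.int.

Lemma tame_cst c : dyadic c -> tame (fun=> c).
Proof.
move=> dc; split=> [s t st|].
  by rewrite lexx lerDl subr_ge0.
by exists (ord2 c) => n le_n x _; rewrite ord2_grid.
Qed.

Lemma tame_subl f : tame f -> tame (fun t => t - f t).
Proof.
case=> fmono [N fN]; split=> [s t st|].
  by have := fmono s t st; lra.
by exists N => n le_n x xn; rewrite mulrBl rpredB // fN.
Qed.

(** Freezing the argument at [m] produces the mast above the temperature; the grid must be fine
    enough to contain [m]. *)
Lemma tame_min f m : dyadic m -> tame f -> tame (fun t => f (Num.min t m)).
Proof.
move=> dm [fmono [N fN]]; split=> [s t st|].
  have := fmono (Num.min s m) (Num.min t m).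
  by rewrite !minElt; case: ifP; case: ifP; lra.
exists (maxn N (ord2 m)) => n; rewrite geq_max => /andP[le_N le_m] x xn.
by apply: fN => //; rewrite minElt; case: ifP => // _; rewrite ord2_grid.
Qed.

Lemma tame_dyadic f x : tame f -> dyadic x -> dyadic (f x).
Proof.
case=> _ [N fN] dx; apply/dyadicE; exists (maxn N (ord2 x)).
by apply: fN; [exact: leq_maxl | rewrite ord2_grid ?leq_maxr].
Qed.

Lemma tame_common_grid (F : game -> rat -> rat) (gs : seq game) :
  (forall g, g \in gs -> tame (F g)) ->
  exists N, forall g, g \in gs -> forall n, (N <= n)%N -> forall x : rat,
    x * 2 ^+ n \is a Num.int -> F g x * 2 ^+ n \is a Num.int.
Proof.
elim: gs => [|g gs IH] tF; first by exists 0%N.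
have [h hgs|N hN] := IH; first by apply: tF; rewrite inE hgs orbT.
have [_ [M hM]] := tF g (mem_head _ _).
exists (maxn N M) => h; rewrite inE => hgs n; rewrite geq_max => /andP[le_N le_M].
by case/orP: hgs => [/eqP->|hgs]; [exact: hM | exact: hN].
Qed.

Lemma tame_mins (F : game -> rat -> rat) (gs : seq game) :
  (forall g, g \in gs -> tame (F g)) ->
  tame (fun t => mins [seq F g t | g <- gs]).
Proof.
move=> tF; have [->|gs_neq0] := eqVneq gs [::].
  rewrite (_ : (fun t => _) = fun=> 0); first exact/tame_cst/(dyadic_int 0).
  by apply/funext => t; rewrite /mins big_nil.
have att t : exists2 g, g \in gs & mins [seq F g t | g <- gs] = F g t.
  have /mins_mem/mapP[g ggs ->] : [seq F g t | g <- gs] != [::].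
    by case: (gs) gs_neq0.
  by exists g.
have le_min g t : g \in gs -> mins [seq F g t | g <- gs] <= F g t.
  by move=> ggs; apply/mins_le/(map_f (fun g => F g t)).
split=> [s t st|].
  (* Monotonicity goes through the function attaining the minimum at [t], the Lipschitz bound
     through the one attaining it at [s]. *)
  have [g ggs mt] := att t; have [h hgs ms] := att s.
  have [/(_ s t st)/andP[g1 _] _] := tF g ggs.
  have [/(_ s t st)/andP[_ h2] _] := tF h hgs.
  have := le_min g s ggs; have := le_min h t hgs; lra.
have [N hN] := tame_common_grid tF.
exists N => n le_n x xn; have [g ggs ->] := att x; exact: hN.
Qed.

(** The increment over a cell of width [d] is an integer multiple of [d] lying between 0 and [d].
    Both extreme values leave no freedom inside the cell. *)
Lemma tame_cell (f : rat -> rat) (N n : nat) (x : rat) :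
    (forall s t : rat, s <= t -> f s <= f t <= f s + (t - s)) ->
    (forall n, (N <= n)%N -> forall x : rat,
       x * 2 ^+ n \is a Num.int -> f x * 2 ^+ n \is a Num.int) ->
    (N <= n)%N -> x * 2 ^+ n \is a Num.int ->
  exists k : bool, forall u,
    x <= u <= x + (2 ^+ n)^-1 -> f u = f x + k%:R * (u - x).
Proof.
move=> fmono fN le_n xn; set d := (2 ^+ n)^-1.
have d_gt0 : 0 < d by exact: Vexpr2_gt0.
have dn : d * 2 ^+ n = 1 by rewrite mulVf ?expr2_neq0.
have : (f (x + d) - f x) * 2 ^+ n \is a Num.int.
  by rewrite mulrBl rpredB ?fN // mulrDl dn rpredD ?rpred1.
case/intrP=> k kE.
have fd : f (x + d) - f x = k%:~R * d by rewrite -kE -mulrA (mulrC _ d) dn mulr1.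
have /andP[f0 f1] := fmono x (x + d) ltac:(lra).
have k0 : 0 <= k.
  by rewrite -(ler0z rat) -(pmulr_lge0 _ d_gt0) -fd; lra.
have k1 : k <= 1.
  by rewrite -(lerz1 rat) -(ler_pM2r d_gt0) -fd; lra.
have [k_eq|k_eq] : k = 0 \/ k = 1 by lia.
- exists false => u /andP[xu ud]; rewrite mul0r addr0.
  have := fmono _ _ xu; have := fmono _ _ ud; move: fd; rewrite k_eq mul0r; lra.
- exists true => u /andP[xu ud]; rewrite mul1r.
  have := fmono _ _ xu; have := fmono _ _ ud; move: fd; rewrite k_eq mul1r; lra.
Qed.

(** A search along the grid replaces completeness of the reals: the first grid point with [f <= g]
    ends a cell on which both functions are linear, and the crossing is solved for there. Earlier
    points are excluded because [f - g] never increases. *)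
Lemma first_meet (f g : rat -> rat) (a T : rat) :
    tame (fun t => - f t) -> tame g -> dyadic a ->
    g a < f a -> a <= T -> f T <= g T ->
  exists m, [/\ dyadic m, a < m, f m = g m & forall s, s < m -> g s < f s].
Proof.
case=> /= fmono [Nf fN] [gmono [Ng gN]] da gfa aT fgT.
pose n := maxn (ord2 a) (maxn Nf Ng); pose d : rat := (2 ^+ n)^-1.
have [na nf ng] : [/\ ord2 a <= n, Nf <= n & Ng <= n]%N.
  by rewrite /n !leq_max !leqnn !orbT.
have d_gt0 : 0 < d by exact: Vexpr2_gt0.
have dn : d * 2 ^+ n = 1 by rewrite mulVf ?expr2_neq0.
pose x i : rat := a + i%:R * d.
have xn i : x i * 2 ^+ n \is a Num.int.
  by rewrite mulrDl -mulrA dn mulr1 rpredD ?ord2_grid // intr_nat.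
have xS i : x i.+1 = x i + d by rewrite /x -natr1; ring.
have exi : exists i, f (x i) <= g (x i).
  have [i Ti] : exists i : nat, (T - a) / d <= i%:R.
    exists (Num.bound ((T - a) / d)); apply/ltW/archi_boundP.
    by rewrite divr_ge0 ?subr_ge0 // ltW.
  exists i; have le_Tx : T <= x i by move: Ti; rewrite ler_pdivrMr // /x; lra.
  by have := fmono _ _ le_Tx; have := gmono _ _ le_Tx; lra.
case: (ex_minnP exi) => -[|i] fgi min_i.
  by move: fgi; rewrite /x mul0r addr0 leNgt gfa.
have gfi : g (x i) < f (x i).
  by rewrite ltNge; apply/negP => /min_i; rewrite ltnn.
have [kf fE] := @tame_cell (fun t => - f t) _ _ _ fmono fN nf (xn i).
have [kg gE] := tame_cell gmono gN ng (xn i).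
rewrite /= -/d in fE gE.
have [] := (fE (x i.+1), gE (x i.+1)); rewrite xS => fEd gEd.
(* The rate at which the gap closes on this cell: positive because the gap does close, hence 1 or 2.
   Division by it costs at most one grid level, so the crossing is dyadic. *)
pose c : rat := kf%:R + kg%:R.
have [dD dc] : f (x i) - g (x i) <= c * d /\ 0 < c.
  have : f (x i) - g (x i) <= c * d.
    move: fgi; rewrite xS /c.
    by have := fEd ltac:(lra); have := gEd ltac:(lra); lra.
  split=> //; rewrite -(pmulr_lgt0 _ d_gt0); lra.
pose m := x i + (f (x i) - g (x i)) / c.
have mi : x i < m by rewrite ltrDl divr_gt0 // subr_gt0.
have md : m <= x i + d by rewrite lerD2l ler_pdivrMr // mulrC.
have ltm s : s < m -> g s < f s.
  move=> sm; have [si|/ltW is_] := leP s (x i).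
    by have := fmono _ _ si; have := gmono _ _ si; lra.
  have := fE s ltac:(lra); have := gE s ltac:(lra).
  have : c * (s - x i) < f (x i) - g (x i).
    by rewrite mulrC -ltr_pdivlMr // ltrBlDl.
  by rewrite /c; lra.
exists m; split=> //.
- apply: dyadicD; first by apply/dyadicE; exists n.
  apply/dyadicE; exists n.+1.
  have : (f (x i) - g (x i)) * 2 ^+ n \is a Num.int.
    by rewrite mulrBl rpredB ?gN // -rpredN -mulNr fN.
  case/intrP=> k kE.
  have -> : (f (x i) - g (x i)) / c * 2 ^+ n.+1 = k%:~R * (c^-1 * 2).
    by rewrite -kE exprSr; ring.
  have -> : c^-1 * 2 = (if kf && kg then 1 else 2).
    by move: dc; rewrite /c; case: (kf); case: (kg) => //=; lra.
  by case: ifP; rewrite rpredM ?intr_int ?rpred1.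
- by apply: le_lt_trans mi; rewrite lerDl mulr_ge0 // ltW.
- have := fE m ltac:(lra); have := gE m ltac:(lra).
  have : c * (m - x i) = f (x i) - g (x i).
    by rewrite /m addrAC subrr add0r mulrC divfK // gt_eqF.
  by rewrite /c; lra.
Qed.

(** * Walls of a game and their first meeting *)

Lemma rho_tilde_le t G r : r \in right_opts G -> rho_tilde t G <= lam t r + t.
Proof. by move=> or; apply/mins_le/(map_f (fun r => lam t r + t)). Qed.

Lemma rho_tilde_att t G : right_opts G != [::] ->
  exists2 r, r \in right_opts G & rho_tilde t G = lam t r + t.
Proof.
move=> R0; rewrite /rho_tilde.
have /mins_mem/mapP[r or ->] : [seq lam t r + t | r <- right_opts G] != [::].
  by case: (right_opts G) R0.
by exists r.
Qed.

Lemma left_opts_oppK G l : (oppg l \in right_opts (oppg G)) = (l \in left_opts G).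
Proof. by rewrite right_opts_opp mem_map //; exact/inv_inj/oppgK. Qed.

Lemma right_opts_oppK G r : (oppg r \in left_opts (oppg G)) = (r \in right_opts G).
Proof. by rewrite left_opts_opp mem_map //; exact/inv_inj/oppgK. Qed.

Lemma lam_tilde_ge t G l : l \in left_opts G -> rho t l - t <= lam_tilde t G.
Proof.
rewrite -left_opts_oppK => /(rho_tilde_le t).
rewrite rho_tilde_opp lam_opp; lra.
Qed.

Lemma lam_tilde_att t G : left_opts G != [::] ->
  exists2 l, l \in left_opts G & lam_tilde t G = rho t l - t.
Proof.
move=> L0; have [|r] := @rho_tilde_att t (oppg G).
  by rewrite right_opts_opp; case: (left_opts G) L0.
rewrite right_opts_opp => /mapP[l ol ->]; rewrite rho_tilde_opp lam_opp => e.
exists l => //; lra.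
Qed.

Lemma tame_rho_tilde G :
  (forall r, r \in right_opts G -> tame (rho^~ (oppg r))) -> tame (rho_tilde^~ G).
Proof.
move=> tR; rewrite (_ : rho_tilde^~ G =
    fun t => mins [seq t - rho t (oppg r) | r <- right_opts G]).
  by apply: (@tame_mins (fun r t => t - rho t (oppg r))) => r /tR/tame_subl.
apply/funext => t; congr mins; apply/eq_map => r.
by rewrite rho_opp opprK addrC.
Qed.

Lemma tame_lam_tilde G :
  (forall l, l \in left_opts G -> tame (rho^~ l)) ->
  tame (fun t => - lam_tilde t G).
Proof.
move=> tL; rewrite (_ : (fun t => _) = rho_tilde^~ (oppg G)).
  apply: tame_rho_tilde => r; rewrite right_opts_opp => /mapP[l ol ->].
  by rewrite oppgK; apply: tL.
by apply/funext => t; rewrite rho_tilde_opp.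
Qed.

(* Simplicity: of the integers between the options, the one nearest to 0 is
   the value. *)
Lemma equals_integer_between G (n : int) :
  (forall l, l \in left_opts G -> ~~ geg l (num_game n%:~R)) ->
  (forall r, r \in right_opts G -> ~~ geg (num_game n%:~R) r) ->
  equals_integer G.
Proof.
have pos (k : nat) : forall G,
    (forall l, l \in left_opts G -> ~~ geg l (num_game k%:~R)) ->
    (forall r, r \in right_opts G -> ~~ geg (num_game k%:~R) r) ->
    equals_integer G.
  elim: k => [|k IH] {}G lG rG.
    exists 0; apply/andP; split; apply/gegP; rewrite num_game_int; split=> g //.
    - by move=> /rG; rewrite num_game_int.
    - by move=> /lG; rewrite num_game_int.
  (* Either [k] lies between the options as well, or a Left option is at least [k], which makes
     [k.+1] the simplest fit. *)
  have [/allP lk|/allPn[l ol]] :=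
      boolP (all (fun l => ~~ geg l (num_game k%:~R)) (left_opts G)).
    apply: IH => // r /rG; apply: contra => kr; apply: geg_trans kr.
    by rewrite geg_num ?ler_int ?lez_nat //; apply: dyadic_int.
  rewrite negbK => lk; exists k.+1; apply/andP; split; apply/gegP; split=> //.
  - move=> g; rewrite num_game_int /= inE => /eqP ->.
    rewrite -[nat_game k]/(int_game k) -num_game_int.
    by apply/negP => /gegP[_ /(_ l ol)]; rewrite lk.
  - by move=> g; rewrite num_game_int.
case: n => [k|k] lG rG; first exact: pos lG rG.
apply/equals_integer_opp; apply: (pos k.+1) => g.
- rewrite left_opts_opp => /mapP[r or ->].
  by rewrite -[k.+1%:Z]opprK rmorphN /= num_gameN geg_opp -NegzE rG.
- rewrite right_opts_opp => /mapP[l ol ->].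
  by rewrite -[k.+1%:Z]opprK rmorphN /= num_gameN geg_opp -NegzE lG.
Qed.

Lemma seq_strict_ub (s : seq rat) : exists n : int, forall x, x \in s -> x < n%:~R.
Proof.
elim: s => [|x s [n IH]]; first by exists 0.
exists (Num.max n (Num.floor x + 1)) => y; rewrite inE => /orP[/eqP->|/IH yn].
- apply: lt_le_trans (_ : (Num.floor x + 1)%:~R <= _).
    exact: floorD1_gt.
  by rewrite ler_int le_max lexx orbT.
- by apply: lt_le_trans yn _; rewrite ler_int le_max lexx.
Qed.

(** The last two fields feed each other: at [t = -1] a Left option [l >= n] contributes at least
    [n + 1] to the Left wall, and a Right option with Left wall at least [n + 1] contributes at
    least [n] to the Right wall. *)
Record thermal_spec (G : game) : Prop := ThermalSpec {
  tame_rho : tame (rho^~ G);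
  rho_le_lam : forall t, rho t G <= lam t G;
  rho_N1_int : rho (-1) G \is a Num.int;
  rho_N1_ge : forall n : int, geg G (num_game n%:~R) -> n%:~R <= rho (-1) G;
  lam_N1_gt : forall n : int, ~~ geg (num_game n%:~R) G ->
    n%:~R + 1 <= lam (-1) G
}.

Record meet_spec (G : game) (m : rat) : Prop := MeetSpec {
  meet_dyadic : dyadic m;
  meet_gtN1 : -1 < m;
  meet_min : min_meet (lam_tilde^~ G) (rho_tilde^~ G) = m;
  meet_eq : lam_tilde m G = rho_tilde m G;
  meet_lt : forall t, t < m -> rho_tilde t G < lam_tilde t G;
  meet_left : left_opts G != [::];
  meet_right : right_opts G != [::]
}.

Lemma meet_exists G : ~ equals_integer G ->
    (forall l, l \in left_opts G -> thermal_spec l /\ thermal_spec (oppg l)) ->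
    (forall r, r \in right_opts G -> thermal_spec r /\ thermal_spec (oppg r)) ->
  exists m, meet_spec G m.
Proof.
move=> nG okL okR.
(* The bounds at [-1] turn an integer between the option walls into one between the options
   themselves, which would be the value of [G]. *)
have notfit (n : int) : 
    (forall l, l \in left_opts G -> rho (-1) l < n%:~R) ->
    (forall r, r \in right_opts G -> n%:~R < lam (-1) r) -> False.
  move=> ln rn; apply: nG; apply: (@equals_integer_between _ n) => g og.
  - apply/negP => gn; have := ln g og.
    have [/rho_N1_ge/(_ n gn) + _] := okL g og; lra.
  - apply/negP => ng; have := rn g og.
    have [_ /rho_N1_ge/(_ (- n))] := okR g og.
    rewrite rmorphN /= num_gameN geg_opp rho_opp => /(_ ng); lra.
have L0 : left_opts G != [::].
  apply/eqP => L0.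
  have [n nP] := seq_strict_ub [seq - lam (-1) r | r <- right_opts G].
  apply: (notfit (- n)) => [l|r or]; first by rewrite L0.
  have := nP _ (map_f (fun r => - lam (-1) r) or); rewrite rmorphN /=; lra.
have R0 : right_opts G != [::].
  apply/eqP => R0.
  have [n nP] := seq_strict_ub [seq rho (-1) l | l <- left_opts G].
  apply: (notfit n) => [l ol|r]; last by rewrite R0.
  exact: nP _ (map_f (rho (-1)) ol).
have tl : tame (fun t => - lam_tilde t G).
  by apply: tame_lam_tilde => l /okL[/tame_rho].
have tr : tame (rho_tilde^~ G).
  by apply: tame_rho_tilde => r /okR[_ /tame_rho].
have gtN1 : rho_tilde (-1) G < lam_tilde (-1) G.
  rewrite ltNge; apply/negP => le_lr.
  have [l0 ol0 lE] := lam_tilde_att (-1) L0.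
  have [l0ok _] := okL _ ol0; have /intrP[k kE] := rho_N1_int l0ok.
  (* Here [lam_tilde (-1) G = k + 1], so Left options have [rho] at most [k], and Right options have
     [lam] at least [k + 2]. *)
  apply: (notfit (k + 1)) => [l ol|r or]; rewrite rmorphD /=.
  - have := lam_tilde_ge (-1) ol; lra.
  - have := rho_tilde_le (-1) or; lra.
have [n nP] := seq_strict_ub [seq lam (-1) l | l <- left_opts G].
(* Past [-1] the [lam] of every Left option stays below [n], so the Left wall at [T] is below
   [n - T], hence below [rho_tilde (-1) G], which the Right wall never goes under again. *)
pose T := Num.max (-1) (n%:~R - rho_tilde (-1) G).
have T1 : -1 <= T by rewrite le_max lexx.
have T2 : n%:~R - rho_tilde (-1) G <= T by rewrite le_max lexx orbT.
have lamT : lam_tilde T G <= rho_tilde T G.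
  have [l ol ->] := lam_tilde_att T L0.
  have := nP _ (map_f (lam (-1)) ol).
  have [lok lNok] := okL _ ol.
  have [/(_ _ _ T1) + _] := tame_rho lNok; rewrite !rho_opp.
  have := rho_le_lam lok T.
  have [/(_ _ _ T1) + _] := tr.
  lra.
have [m [dm m1 me mlt]] := first_meet tl tr (dyadic_int (-1)) gtN1 T1 lamT.
exists m; split=> //.
rewrite /min_meet; apply: xget_unique.
  split=> // s _ e; rewrite leNgt; apply/negP => /mlt; rewrite e ltxx //.
move=> s [ds e hs]; apply/eqP; rewrite eq_le hs //.
by rewrite leNgt; apply/negP => /mlt; rewrite e ltxx.
Qed.

Lemma lam_nonint G m t : ~ equals_integer G -> meet_spec G m ->
  lam t G = lam_tilde (Num.min t m) G.
Proof.
move=> nG ms; have [_ /(_ t)[-> _ _]] := thermo_nonint nG.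
by rewrite (meet_min ms) /Num.min; case: ltgtP => // ->.
Qed.

Lemma rho_nonint G m t : ~ equals_integer G -> meet_spec G m ->
  rho t G = rho_tilde (Num.min t m) G.
Proof.
move=> nG ms; have [_ /(_ t)[_ -> _]] := thermo_nonint nG.
by rewrite (meet_min ms) /Num.min; case: ltgtP => // ->.
Qed.

(** Induction is on size because the hypothesis is also needed for the negatives of options, which
    are not options of [G] but have the same size as those options. *)
Lemma thermal_specP G : thermal_spec G.
Proof.
have [n] := ubnP (gsize G); elim: n G => // n IH G le_n.
have okL l : l \in left_opts G -> thermal_spec l /\ thermal_spec (oppg l).
  by move=> /gsize_left lt_l; split; apply: IH; rewrite ?gsize_opp; lia.
have okR r : r \in right_opts G -> thermal_spec r /\ thermal_spec (oppg r).
  by move=> /gsize_right lt_r; split; apply: IH; rewrite ?gsize_opp; lia.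
have [Gint|nG] := pselect (equals_integer G).
  have [k [/andP[Gk kG] _ thE]] := thermo_int Gint.
  split.
  - rewrite (_ : rho^~ G = fun=> k%:~R); first exact/tame_cst/dyadic_int.
    by apply/funext => t; case: (thE t).
  - by move=> t; case: (thE t) => -> ->.
  - by case: (thE (-1)) => _ -> _; rewrite intr_int.
  - move=> j Gj; case: (thE (-1)) => _ -> _.
    have := geg_trans kG Gj; rewrite geg_num //; exact: dyadic_int.
  - move=> j jG; case: (thE (-1)) => -> _ _.
    rewrite -[1]/(1%:~R) -rmorphD ler_int lezD1 -(ltr_int rat) ltNge.
    rewrite -geg_num; try exact: dyadic_int.
    by apply: contra jG => jk; apply: geg_trans jk kG.
have [m ms] := meet_exists nG okL okR.
(* The walls meet strictly above [-1], so truncation does not affect the values there. *)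
have N1 : Num.min (-1) m = -1 by apply: min_idPl; exact/ltW/(meet_gtN1 ms).
have tr : tame (rho_tilde^~ G).
  by apply: tame_rho_tilde => r /okR[_ /tame_rho].
split.
- rewrite (_ : rho^~ G = fun t => rho_tilde (Num.min t m) G).
    exact: tame_min (meet_dyadic ms) tr.
  by apply/funext => t; rewrite (rho_nonint _ nG ms).
- move=> t; rewrite (rho_nonint _ nG ms) (lam_nonint _ nG ms).
  have : Num.min t m <= m by rewrite ge_min lexx orbT.
  rewrite le_eqVlt => /orP[/eqP ->|/(meet_lt ms)/ltW//].
  by rewrite (meet_eq ms).
- rewrite (rho_nonint _ nG ms) N1.
  have [r or ->] := rho_tilde_att (-1) (meet_right ms).
  have [_ /rho_N1_int] := okR r or; rewrite rho_opp rpredN => h.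
  by rewrite rpredD // rpredN rpred1.
- move=> j /gegP[Gj _]; rewrite (rho_nonint _ nG ms) N1.
  have [r or ->] := rho_tilde_att (-1) (meet_right ms).
  have [/lam_N1_gt/(_ j (Gj r or)) + _] := okR r or; lra.
- move=> j nj; rewrite (lam_nonint _ nG ms) N1.
  have [[l ol lj]|[y [dy yint Gy]]] := geg_left_num (dyadic_int j) nj.
    have := lam_tilde_ge (-1) ol.
    have [/rho_N1_ge/(_ j lj) + _] := okL l ol; lra.
  by case: nG; have /intrP[k yE] := yint (intr_int _ _); exists k; rewrite -yE.
Qed.

Lemma meet_specP G : ~ equals_integer G -> exists m, meet_spec G m.
Proof. by move=> nG; apply: meet_exists => // *; split; exact: thermal_specP. Qed.

(** * Cooled games *)

Lemma rho_mono s t G : s <= t -> rho s G <= rho t G <= rho s G + (t - s).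
Proof. by case: (tame_rho (thermal_specP G)) => + _; apply. Qed.

Lemma lam_mono s t G : s <= t -> lam t G <= lam s G <= lam t G + (t - s).
Proof. by move=> /(@rho_mono _ _ (oppg G)); rewrite !rho_opp; lra. Qed.

Lemma dyadic_rho t G : dyadic t -> dyadic (rho t G).
Proof. exact: tame_dyadic (tame_rho (thermal_specP G)). Qed.

Lemma cool_nonint G m t : ~ equals_integer G -> meet_spec G m ->
  cool t G = if t <= m then cool_tilde t G else num_game (lam_tilde m G).
Proof.
move=> nG ms; have [_ /(_ t)[_ _ ->]] := thermo_nonint nG.
by rewrite (meet_min ms).
Qed.

Lemma meet_spec_opp G m : meet_spec G m -> meet_spec (oppg G) m.
Proof.
have ltE : lam_tilde^~ (oppg G) = (fun u => - rho_tilde u G).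
  by apply/funext => u; exact: lam_tilde_opp.
have rtE : rho_tilde^~ (oppg G) = (fun u => - lam_tilde u G).
  by apply/funext => u; exact: rho_tilde_opp.
case=> dm m1 mm me mlt L0 R0; split=> //.
- by rewrite ltE rtE min_meetN.
- by rewrite lam_tilde_opp rho_tilde_opp me.
- by move=> t /mlt; rewrite lam_tilde_opp rho_tilde_opp ltrN2.
- by rewrite left_opts_opp; case: (right_opts G) R0.
- by rewrite right_opts_opp; case: (left_opts G) L0.
Qed.

Lemma cool_opp t G : cool t (oppg G) = oppg (cool t G).
Proof.
elim/game_opts_ind: G => G IHL IHR.
have [Gint|nG] := pselect (equals_integer G).
  have [n [_ _ /(_ t)[lG _ ->]]] := thermo_int Gint.
  have /equals_integer_opp/thermo_int[k [_ _ /(_ t)[_ rG ->]]] := Gint.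
  by rewrite -rG rho_opp lG num_gameN.
have nNG : ~ equals_integer (oppg G) by move=> /equals_integer_opp.
have [m ms] := meet_specP nG; have msN := meet_spec_opp ms.
rewrite (cool_nonint t nG ms) (cool_nonint t nNG msN); case: ifP => _; last first.
  by rewrite lam_tilde_opp -(meet_eq ms) num_gameN.
apply: game_ext; rewrite /= !(left_opts_opp, right_opts_opp) -!map_comp.
- by apply/eq_in_map => r or /=; rewrite IHR // /subg oppgD.
- by apply/eq_in_map => l ol /=; rewrite IHL // /subg oppgD oppgK.
Qed.

(** * Comparing a cooled game with numbers *)

(** A single earlier point [s] encodes the slope to the left of [t]: since [rho] is monotone and
    1-Lipschitz, its value there makes it flat, or of slope 1, on all of [[s, t]]. *)
Record cool_spec (t : rat) (G : game) : Prop := CoolSpec {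
  cool_ge : forall x, dyadic x -> x < rho t G ->
    geg (cool t G) (num_game x);
  cool_nge : forall x, dyadic x -> rho t G < x ->
    ~~ geg (cool t G) (num_game x);
  cool_ge_rho : forall s, s < t -> rho s G = rho t G ->
    geg (cool t G) (num_game (rho t G));
  cool_nge_rho : forall s, s < t -> rho s G = rho t G - (t - s) ->
    ~~ geg (cool t G) (num_game (rho t G))
}.

(** Serves integers and the mast above the temperature. The wall is flat to the left of [t], so the
    slope 1 hypothesis is contradictory. *)
Lemma cool_spec_num t G : cool t G = num_game (rho t G) -> dyadic t ->
  (exists2 s, s < t & rho s G = rho t G) -> cool_spec t G.
Proof.
move=> cE dt [s0 s0t s0E]; have dr := dyadic_rho G dt.
split; rewrite cE.
- by move=> x dx /ltW; rewrite geg_num.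
- by move=> x dx; rewrite geg_num // -ltNge.
- by move=> *; rewrite geg_refl.
- move=> s st sE; have [s0s|/ltW ss0] := leP s0 s.
    have := @rho_mono _ _ G s0s; lra.
  have := @rho_mono _ _ G ss0; lra.
Qed.

Lemma cool_specP t G : dyadic t -> cool_spec t G.
Proof.
move=> dt; have [n] := ubnP (gsize G); elim: n G => // n IH G le_n.
have [Gint|nG] := pselect (equals_integer G).
  have [k [_ _ thE]] := thermo_int Gint.
  apply: cool_spec_num => //; first by case: (thE t) => _ -> ->.
  by exists (t - 1); [lra | case: (thE t) => _ -> _; case: (thE (t - 1))].
have [m ms] := meet_specP nG.
have [tm|mt] := leP t m; last first.
  apply: cool_spec_num => //.
    rewrite (cool_nonint t nG ms) leNgt mt /= (rho_nonint _ nG ms).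
    by rewrite (min_idPr _) ?ltW // (meet_eq ms).
  exists m => //; rewrite !(rho_nonint _ nG ms) minxx.
  by rewrite (min_idPr _) ?ltW.
have rhoE s : s <= t -> rho s G = rho_tilde s G.
  by move=> st; rewrite (rho_nonint _ nG ms) (min_idPl _) ?(le_trans st).
have le_rl : rho_tilde t G <= lam_tilde t G.
  move: tm; rewrite le_eqVlt => /orP[/eqP ->|/(meet_lt ms)/ltW//].
  by rewrite (meet_eq ms).
have IHL l : l \in left_opts G -> cool_spec t l.
  by move=> /gsize_left lt_l; apply: IH; lia.
have IHR r : r \in right_opts G -> cool_spec t (oppg r).
  by move=> /gsize_right lt_r; apply: IH; rewrite gsize_opp; lia.
have cE : cool t G = cool_tilde t G by rewrite (cool_nonint t nG ms) tm.
have geR r x : dyadic x ->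
    geg (num_game x) (addg (cool t r) (num_game t)) =
    geg (cool t (oppg r)) (num_game (t - x)).
  move=> dx; rewrite -geg_opp oppgD -cool_opp -[oppg (num_game x)]num_gameN.
  by rewrite -/(subg _ _) geg_sub_num //; exact: dyadicN.
(* By number avoidance the only obstacle is that the cooled game equals a number [z]. Then no cooled
   Left option reaches [z], so [rho t l - t <= z] for each [l], whence [x <= lam_tilde t G <= z]. *)
have ge_of_right x : dyadic x -> x <= rho t G ->
    (forall r, r \in right_opts G ->
       ~~ geg (cool t (oppg r)) (num_game (t - x))) ->
    geg (cool t G) (num_game x).
  move=> dx xr nR; have [|//|[z dz Gz]] := @geg_right_num (cool t G) x dx.
    by move=> r; rewrite cE /= => /mapP[r' or ->]; rewrite geR // nR.
  have /andP[Gz1 Gz2] := Gz; apply: geg_trans Gz1 _; rewrite geg_num //.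
  apply: le_trans xr _; rewrite rhoE //; apply: le_trans le_rl _.
  have [l ol ->] := lam_tilde_att t (meet_left ms).
  rewrite leNgt; apply/negP => zl.
  have /gegP[_ /(_ (subg (cool t l) (num_game t)))] := Gz2.
  rewrite cE /= (map_f (fun l => subg (cool t l) (num_game t))) // => /(_ isT).
  rewrite geg_sub_num // (cool_ge (IHL l ol)) //; first exact: dyadicD.
  lra.
have nge_of_right x r : dyadic x -> r \in right_opts G ->
    geg (cool t (oppg r)) (num_game (t - x)) -> ~~ geg (cool t G) (num_game x).
  move=> dx or h; apply/negP => /gegP[/(_ (addg (cool t r) (num_game t)))].
  rewrite cE /= (map_f (fun r => addg (cool t r) (num_game t))) // => /(_ isT).
  by rewrite geR // h.
have R0 := meet_right ms.
have dr := dyadic_rho G dt.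
split.
- move=> x dx xr; apply: ge_of_right => // [|r or]; first exact: ltW.
  apply: (cool_nge (IHR r or)); first exact: dyadicB.
  have := rho_tilde_le t or; move: xr; rewrite rhoE // rho_opp; lra.
- move=> x dx; rewrite rhoE //; have [r or ->] := rho_tilde_att t R0 => rx.
  apply: (nge_of_right _ r) => //; apply: (cool_ge (IHR r or)).
    exact: dyadicB.
  rewrite rho_opp; lra.
(* If [r] attains the minimum at [t] and the wall is flat, [lam s r] must exceed [lam t r] by the
   full [t - s]; thus [rho] of [oppg r] has slope 1. *)
- move=> s st sE; apply: ge_of_right => // r or.
  have := rho_tilde_le t or; rewrite -rhoE // => le_t.
  have [lt_t|ge_t] := ltP (rho t G) (lam t r + t).
    apply: (cool_nge (IHR r or)); first exact: dyadicB.
    rewrite rho_opp; lra.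
  have -> : t - rho t G = rho t (oppg r) by rewrite rho_opp; lra.
  apply: (cool_nge_rho (IHR r or) st).
  have := rho_tilde_le s or; rewrite -(rhoE s (ltW st)) sE.
  have := @lam_mono _ _ r (ltW st); rewrite !rho_opp; lra.
(* With slope 1, the option attaining the minimum at [s] has constant [lam] up to [t] and still
   attains the minimum there. *)
- move=> s st; rewrite (rhoE s (ltW st)).
  have [r or ->] := rho_tilde_att s R0 => sE.
  have := rho_tilde_le t or; rewrite -rhoE // => le_t.
  have := @lam_mono _ _ r (ltW st) => mono.
  apply: (nge_of_right _ r) => //.
  have -> : t - rho t G = rho t (oppg r) by rewrite rho_opp; lra.
  by apply: (cool_ge_rho (IHR r or) st); rewrite !rho_opp; lra.
Qed.

(* At small dyadic scale the walls are linear with slope 0 or 1 to the left of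
   t, so a strict decrease of lam_tilde has slope exactly -1. *)
Lemma lam_tilde_step t a G : dyadic t -> a < t ->
  exists s, [/\ dyadic s, a < s, s < t &
    lam_tilde s G = lam_tilde t G \/ lam_tilde s G = lam_tilde t G + (t - s)].
Proof.
move=> dt at_; have [|/= mono [N fN]] := @tame_lam_tilde G.
  by move=> l _; exact: tame_rho (thermal_specP l).
(* Since [2 ^ n > n >= k], this [k] makes the cell width [d] smaller than [t - a]. *)
have [k kP] : exists k : nat, (t - a)^-1 < k%:R.
  exists (Num.bound (t - a)^-1); apply: archi_boundP.
  by rewrite invr_ge0 subr_ge0 ltW.
pose n := maxn (ord2 t) (maxn N k); pose d : rat := (2 ^+ n)^-1.
have [nt nN nk] : [/\ ord2 t <= n, N <= n & k <= n]%N.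
  by rewrite /n !leq_max !leqnn !orbT.
have d_gt0 : 0 < d by exact: Vexpr2_gt0.
have dn : d * 2 ^+ n = 1 by rewrite mulVf ?expr2_neq0.
have d_lt : d < t - a.
  rewrite -[ltRHS]invrK ltf_pV2 ?posrE ?expr2_gt0 ?invr_gt0 ?subr_gt0 //.
  apply: lt_trans kP _; rewrite -natrX ltr_nat; apply: leq_ltn_trans nk _.
  by rewrite ltn_expl.
have sn : (t - d) * 2 ^+ n \is a Num.int.
  by rewrite mulrBl dn rpredB ?rpred1 ?ord2_grid.
have [j jE] := @tame_cell (fun t => - lam_tilde t G) _ _ _ mono fN nN sn.
exists (t - d); split; [by apply/dyadicE; exists n | lra | lra | ].
have := jE t; rewrite -/d => /(_ ltac:(lra)).
by case: j {jE} => /= tE; [right|left]; lra.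
Qed.

(** * Cooled options against the walls *)

(** Only a tie [rho t l = t + lam_tilde t G] needs care: as [l] cannot exceed the constant wall at
    [s], [rho s l] lies a full [t - s] below [rho t l], and [cool_nge_rho] applies. *)
Lemma cool_left_lf G a b :
    (forall s t : rat, dyadic s -> dyadic t -> a < s <= b -> a < t <= b ->
       lam_tilde s G = lam_tilde t G) ->
  forall t, dyadic t -> a < t <= b ->
  forall l, l \in left_opts G ->
    lfg (subg (cool t l) (num_game t)) (num_game (lam_tilde t G)).
Proof.
move=> cst t dt /andP[at_ tb] l ol.
have [s [ds as_ st _]] := lam_tilde_step G dt at_.
have dl : dyadic (lam_tilde t G).
  rewrite -[lam_tilde t G]opprK; apply: dyadicN.
  apply: (@tame_dyadic (fun t => - lam_tilde t G)) dt.
  by apply: tame_lam_tilde => g _; exact: tame_rho (thermal_specP g).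
rewrite /lfg geg_sub_num //; have ls := lam_tilde_ge s ol.
have lt := lam_tilde_ge t ol.
have [lt_l|ge_l] := ltP (rho t l) (t + lam_tilde t G).
  by apply: (cool_nge (cool_specP l dt)) => //; exact: dyadicD.
have -> : t + lam_tilde t G = rho t l by lra.
apply: (cool_nge_rho (cool_specP l dt) st).
have := cst s t ds dt ltac:(lra) ltac:(lra).
have := @rho_mono _ _ l (ltW st); lra.
Qed.

(** For an option attaining the wall at [s], slope -1 gives
    [rho s l = t + lam_tilde t G >= rho t l]; monotonicity makes this an equality, and [cool_ge_rho]
    applies. *)
Lemma cool_left_ge G a b : ~ equals_integer G ->
    (forall s t : rat, dyadic s -> dyadic t -> a < s <= b -> a < t <= b ->
       s < t -> lam_tilde t G < lam_tilde s G) ->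
  forall t, dyadic t -> a < t <= b ->
  exists2 l, l \in left_opts G &
    geg (subg (cool t l) (num_game t)) (num_game (lam_tilde t G)).
Proof.
move=> nG decr t dt /andP[at_ tb].
have [s [ds as_ st]] := lam_tilde_step G dt at_.
have := decr s t ds dt ltac:(lra) ltac:(lra) st.
move=> lt_ts [|sE]; first by lra.
have [m ms] := meet_specP nG.
have [l ol lE] := lam_tilde_att s (meet_left ms); exists l => //.
have lt := lam_tilde_ge t ol.
have mono := @rho_mono _ _ l (ltW st).
have tE : t + lam_tilde t G = rho t l by lra.
have dl : dyadic (lam_tilde t G).
  rewrite (_ : lam_tilde t G = rho t l - t); last by lra.
  exact/dyadicB/dt/dyadic_rho.
rewrite geg_sub_num // tE; apply: (cool_ge_rho (cool_specP l dt) st); lra.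
Qed.

Theorem lemma7 (G : game) (a b : rat) :
  ~ equals_integer G -> dyadic a -> dyadic b -> a < b ->
  [/\ (forall s t : rat, dyadic s -> dyadic t -> a < s <= b -> a < t <= b ->
         lam_tilde s G = lam_tilde t G) ->
      forall t : rat, dyadic t -> a < t <= b ->
        forall GL : game, GL \in left_opts G ->
          (cool t GL - num_game t <| num_game (lam_tilde t G))%game,
      (forall s t : rat, dyadic s -> dyadic t -> a < s <= b -> a < t <= b ->
         rho_tilde s G = rho_tilde t G) ->
      forall t : rat, dyadic t -> a < t <= b ->
        forall GR : game, GR \in right_opts G ->
          (num_game (rho_tilde t G) <| cool t GR + num_game t)%game,
      (forall s t : rat, dyadic s -> dyadic t -> a < s <= b -> a < t <= b ->
         s < t -> lam_tilde t G < lam_tilde s G) ->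
      forall t : rat, dyadic t -> a < t <= b ->
        exists2 GL : game, GL \in left_opts G &
          (cool t GL - num_game t >= num_game (lam_tilde t G))%game
    & (forall s t : rat, dyadic s -> dyadic t -> a < s <= b -> a < t <= b ->
         s < t -> rho_tilde s G < rho_tilde t G) ->
      forall t : rat, dyadic t -> a < t <= b ->
        exists2 GR : game, GR \in right_opts G &
          (num_game (rho_tilde t G) >= cool t GR + num_game t)%game].
Proof.
move=> nG _ _ _.
(* The claims on Right options become those on Left options of [oppg G]. *)
have right_opp t GR :
    geg (num_game (rho_tilde t G)) (addg (cool t GR) (num_game t)) =
    geg (subg (cool t (oppg GR)) (num_game t)) (num_game (lam_tilde t (oppg G))).
  rewrite -geg_opp oppgD -cool_opp lam_tilde_opp.
  by rewrite -[oppg (num_game (rho_tilde _ _))]num_gameN.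
split.
- exact: cool_left_lf.
- move=> cst t dt tab GR oR; rewrite /lfg right_opp.
  apply: (@cool_left_lf (oppg G) a b) => //; last by rewrite right_opts_oppK.
  by move=> u v *; rewrite !lam_tilde_opp (cst u v).
- exact: cool_left_ge.
- move=> incr t dt tab.
  have [||g] := @cool_left_ge (oppg G) a b _ _ t dt tab.
  + by move=> /equals_integer_opp.
  + by move=> u v *; rewrite !lam_tilde_opp ltrN2 incr.
  rewrite left_opts_opp => /mapP[r or ->] h; exists r => //.
  by rewrite right_opp.
Qed.
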